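(* For every $n$, there is a bijection between the set $S_n(\{2143,2341,3412\})$ of $\{2143,2341,3412\}$-avoiders in $S_n$ and the set $S_n(\{2143,2341,3421\})$ of $\{2143,2341,3421\}$-avoiders in $S_n$.
   Context: $S_n$ is the set of permutations of $[n]=\{1,\dots,n\}$ in one-line notation. For a set $T$ of patterns, $S_n(T)$ denotes the set of permutations $\pi\in S_n$ that avoid every pattern $\tau\in T$, i.e. no subsequence of $\pi$ is order-isomorphic to $\tau$. *)

(* Defs.v *)
From mathcomp Require Import all_boot all_fingroup.

Set Implicit Arguments.
Unset Strict Implicit.
Unset Printing Implicit Defensive.

(* 'I_n is {0, .., n-1}, so positions and values are shifted by one:          *)
(* one_line s is the word s(1) s(2) .. s(n) with letters in {1, .., n}.       *)
Definition one_line n (s : 'S_n) : seq nat := [seq (s i).+1 | i <- enum 'I_n].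

(* For words without repeated letters, comparing strict inequalities for all  *)
(* ordered pairs of positions determines the relative order completely.       *)
Definition order_isomorphic (u v : seq nat) : bool :=
  (size u == size v) &&
  [forall i : 'I_(size u), forall j : 'I_(size u),
     (nth 0 u i < nth 0 u j) == (nth 0 v i < nth 0 v j)].

(* The masks range over a finite type, so containment is boolean.             *)
Definition contains_pattern (w t : seq nat) : bool :=
  [exists m : (size w).-tuple bool, order_isomorphic (mask m w) t].

Lemma contains_patternP (w t : seq nat) :
  reflect (exists2 u, subseq u w & order_isomorphic u t)
          (contains_pattern w t).
Proof.
apply: (iffP existsP) => [[m Hm]|[u /subseqP[m sz_m ->] Hu]].
  by exists (mask m w) => //; apply: mask_subseq.
have Hm : size m == size w by apply/eqP.
by exists (Tuple Hm).
Qed.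

(* A pattern is given by its one-line notation, a set of patterns by a list.  *)
Definition avoiders n (T : seq (seq nat)) : {set 'S_n} :=
  [set s : 'S_n | all (fun t => ~~ contains_pattern (one_line s) t) T].

(* Main.v *)
Require Import Defs.
From mathcomp Require Import all_boot all_fingroup.
From mathcomp Require Import zify.

(** Call a position [k] of [s] covered if [s k] plays the role of 1 in an
    occurrence of 231.  If [s] avoids 2143, then all covered entries lie to the
    right of and below one single ascent [s x < s y].  Hence such an [s] avoids
    3412 (resp. 3421) iff its covered entries are decreasing (resp. increasing),
    and the bijection reverses the word of covered entries in place.

    This keeps the set of covered positions, so it is an involution.  That it
    also preserves the avoidance of 2143 and 2341 rests on a dichotomy: either
    no uncovered position lies between two covered positions, or no uncovered
    value lies between two covered values; otherwise 2143 or 2341 occurs. *)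

Set Implicit Arguments.
Unset Strict Implicit.
Unset Printing Implicit Defensive.

(** * Patterns of length four as inequalities between values *)

(** Unlike the quantifiers over ordinals, [all] over [iota] computes on a concrete pattern, which
    leaves plain inequalities for [lia]. *)
Lemma order_isomorphic_all (u v : seq nat) :
  order_isomorphic u v = (size u == size v) &&
    all (fun i => all (fun j =>
      (nth 0 u i < nth 0 u j) == (nth 0 v i < nth 0 v j))
      (iota 0 (size u))) (iota 0 (size u)).
Proof.
rewrite /order_isomorphic; congr (_ && _).
apply/forallP/allP => [Huv i | Huv i].
  rewrite mem_iota /= => lti; apply/allP => j; rewrite mem_iota /= => ltj.
  by have /forallP/(_ (Ordinal ltj)) := Huv (Ordinal lti).
apply/forallP => j.
by have /allP := Huv i ltac:(by rewrite mem_iota /=); apply; rewrite mem_iota /=.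
Qed.

Lemma enum_ord_sorted n : sorted (fun i j : 'I_n => i < j) (enum 'I_n).
Proof.
have := iota_ltn_sorted 0 n; rewrite -val_enum_ord.
by rewrite sorted_map.
Qed.

Lemma ltn_ord_trans n : transitive (fun i j : 'I_n => i < j).
Proof. by move=> j i k; apply: ltn_trans. Qed.

Lemma contains_pattern4P n (s : 'S_n) (t : seq nat) : size t = 4 ->
  reflect (exists i j k l : 'I_n, [/\ i < j, j < k, k < l &
      order_isomorphic [:: (s i).+1; (s j).+1; (s k).+1; (s l).+1] t])
    (contains_pattern (one_line s) t).
Proof.
move=> size_t; apply: (iffP (contains_patternP _ _)) => [[u]|].
  case/subseqP => m sz_m ->; rewrite /one_line -map_mask => iso_t.
  have : size (mask m (enum 'I_n)) = 4.
    by case/andP: (iso_t) => /eqP; rewrite size_t size_map.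
  have := sorted_mask (@ltn_ord_trans n) m (enum_ord_sorted n).
  case: (mask m _) iso_t => [|i [|j [|k [|l []]]]] //= iso_t /and4P[ij jk kl _] _.
  by exists i, j, k, l.
case=> [i [j [k [l [ij jk kl iso_t]]]]].
exists (map (fun i => (s i).+1) [:: i; j; k; l]) => //.
apply: map_subseq.
(* Both lists are strictly sorted with the same members, hence equal; a filtered list is visibly a
   subsequence. *)
have -> : [:: i; j; k; l] = filter (mem [:: i; j; k; l]) (enum 'I_n).
  apply: (@irr_sorted_eq _ (fun i j : 'I_n => i < j)).
  - exact: ltn_ord_trans.
  - by move=> p; rewrite ltnn.
  - by rewrite /= ij jk kl.
  - exact: sorted_filter (@ltn_ord_trans n) _ _ (enum_ord_sorted n).
  - by move=> p; rewrite mem_filter mem_enum andbT.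
exact: filter_subseq.
Qed.

(** In this and the next three definitions the chain lists the values of the forbidden occurrence
    from smallest to largest. *)
Definition avoids2143 n (s : 'S_n) := forall i j k l : 'I_n,
  i < j -> j < k -> k < l -> ~~ [&& s j < s i, s i < s l & s l < s k].
Definition avoids2341 n (s : 'S_n) := forall i j k l : 'I_n,
  i < j -> j < k -> k < l -> ~~ [&& s l < s i, s i < s j & s j < s k].
Definition avoids3412 n (s : 'S_n) := forall i j k l : 'I_n,
  i < j -> j < k -> k < l -> ~~ [&& s k < s l, s l < s i & s i < s j].
Definition avoids3421 n (s : 'S_n) := forall i j k l : 'I_n,
  i < j -> j < k -> k < l -> ~~ [&& s l < s k, s k < s i & s i < s j].

Lemma avoids_pattern4P n (s : 'S_n) (t : seq nat) (p : nat -> nat -> nat -> nat -> bool) :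
  size t = 4 ->
  (forall a b c d, order_isomorphic [:: a.+1; b.+1; c.+1; d.+1] t = p a b c d) ->
  (forall i j k l : 'I_n, i < j -> j < k -> k < l -> ~~ p (s i) (s j) (s k) (s l))
    <-> ~~ contains_pattern (one_line s) t.
Proof.
move=> size_t iso_p; split=> [av|/(contains_pattern4P _ size_t) av i j k l ij jk kl].
  apply/(contains_pattern4P _ size_t) => -[i [j [k [l [ij jk kl]]]]].
  by rewrite iso_p; apply/negP/av.
by apply/negP; rewrite -iso_p => iso_t; apply: av; exists i, j, k, l.
Qed.

Lemma avoids2143P n (s : 'S_n) :
  avoids2143 s <-> ~~ contains_pattern (one_line s) [:: 2; 1; 4; 3].
Proof.
apply: (@avoids_pattern4P _ _ _ (fun a b c d => [&& b < a, a < d & d < c])) => //.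
by move=> a b c d; rewrite order_isomorphic_all /=; lia.
Qed.

Lemma avoids2341P n (s : 'S_n) :
  avoids2341 s <-> ~~ contains_pattern (one_line s) [:: 2; 3; 4; 1].
Proof.
apply: (@avoids_pattern4P _ _ _ (fun a b c d => [&& d < a, a < b & b < c])) => //.
by move=> a b c d; rewrite order_isomorphic_all /=; lia.
Qed.

Lemma avoids3412P n (s : 'S_n) :
  avoids3412 s <-> ~~ contains_pattern (one_line s) [:: 3; 4; 1; 2].
Proof.
apply: (@avoids_pattern4P _ _ _ (fun a b c d => [&& c < d, d < a & a < b])) => //.
by move=> a b c d; rewrite order_isomorphic_all /=; lia.
Qed.

Lemma avoids3421P n (s : 'S_n) :
  avoids3421 s <-> ~~ contains_pattern (one_line s) [:: 3; 4; 2; 1].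
Proof.
apply: (@avoids_pattern4P _ _ _ (fun a b c d => [&& d < c, c < a & a < b])) => //.
by move=> a b c d; rewrite order_isomorphic_all /=; lia.
Qed.

(** * Reversal of a set of positions *)

Section Reversal.
Context {n : nat} (P : {set 'I_n}).

Definition rev_fun (i : 'I_n) : 'I_n :=
  if i \in P then nth i (rev (enum P)) (index i (enum P)) else i.

Lemma rev_fun_out i : i \notin P -> rev_fun i = i.
Proof. by rewrite /rev_fun => /negPf ->. Qed.

Lemma rev_fun_index i : i \in P ->
  rev_fun i \in P /\
  index (rev_fun i) (enum P) = #|P| - (index i (enum P)).+1.
Proof.
move=> Pi; rewrite /rev_fun Pi.
have lti : index i (enum P) < size (enum P) by rewrite index_mem mem_enum.
have ltr : size (enum P) - (index i (enum P)).+1 < size (enum P).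
  by rewrite ltn_subrL (leq_trans _ lti).
rewrite nth_rev // cardE; split; last by rewrite index_uniq ?enum_uniq.
by rewrite -mem_enum mem_nth.
Qed.

Lemma rev_funK : involutive rev_fun.
Proof.
move=> i; have [Pi|nPi] := boolP (i \in P); last by rewrite !rev_fun_out.
have [Pr idx_r] := rev_fun_index Pi; have [Prr idx_rr] := rev_fun_index Pr.
apply: (index_inj i (s := enum P)); rewrite ?mem_enum //=.
have : index i (enum P) < #|P| by rewrite cardE index_mem mem_enum.
by rewrite idx_rr idx_r => lti; rewrite -subSn // subSS subKn // ltnW.
Qed.

Definition rev_perm : 'S_n := perm (inv_inj rev_funK).

Lemma rev_permK : (rev_perm * rev_perm = 1)%g.
Proof. by apply/permP => i; rewrite permM perm1 !permE rev_funK. Qed.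

Lemma rev_perm_out i : i \notin P -> rev_perm i = i.
Proof. by rewrite permE; apply: rev_fun_out. Qed.

Lemma rev_perm_in i : i \in P -> rev_perm i \in P.
Proof. by rewrite permE => /rev_fun_index[]. Qed.

(** [enum P] is sorted by position, so reflecting indices in it reverses the order on [P]. *)
Lemma index_enum_ltn i j : i \in P -> j \in P ->
  (index i (enum P) < index j (enum P)) = (i < j).
Proof.
have sP : sorted (fun i j : 'I_n => i < j) (enum P).
  rewrite /enum_mem -enumT.
  exact: sorted_filter (@ltn_ord_trans n) _ _ (enum_ord_sorted n).
have lt_of i' j' : i' \in P -> j' \in P ->
    index i' (enum P) < index j' (enum P) -> i' < j'.
  move=> Pi Pj ltij.
  by apply: (sorted_ltn_index (@ltn_ord_trans n) sP) => //; rewrite mem_enum.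
move=> Pi Pj; apply/idP/idP; first exact: lt_of.
apply: contraLR; rewrite -!leqNgt leq_eqVlt => /predU1P[eq_idx|/lt_of]; last first.
  by move=> /(_ Pj Pi)/ltnW.
by rewrite (index_inj j _ _ eq_idx) ?mem_enum.
Qed.

Lemma rev_perm_anti i j : i \in P -> j \in P -> i < j -> rev_perm j < rev_perm i.
Proof.
move=> Pi Pj; rewrite !permE.
have [Pri idx_i] := rev_fun_index Pi; have [Prj idx_j] := rev_fun_index Pj.
rewrite -!index_enum_ltn // idx_i idx_j.
have : index j (enum P) < #|P| by rewrite cardE index_mem mem_enum.
lia.
Qed.

End Reversal.

(** * Covered positions and their common ascent *)

Definition covered n (s : 'S_n) : {set 'I_n} :=
  [set k : 'I_n | [exists i : 'I_n, exists j : 'I_n,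
    [&& i < j, j < k, s k < s i & s i < s j]]].

Lemma coveredP n (s : 'S_n) (k : 'I_n) :
  reflect (exists i j : 'I_n, [/\ i < j, j < k, s k < s i & s i < s j])
    (k \in covered s).
Proof.
rewrite inE; apply: (iffP existsP) => [[i /existsP[j /and4P H]]|[i [j H]]].
  by exists i, j.
by exists i; apply/existsP; exists j; apply/and4P.
Qed.

(** One ascent that completes every position of [P] to a 231 at once. *)
Definition dominates n (s : 'S_n) (P : {set 'I_n}) (x y : 'I_n) :=
  [/\ x < y, s x < s y & {in P, forall k : 'I_n, y < k /\ s k < s x}].

(** Let [k] be the leftmost covered position and [m] the one of largest value, with ascents [u], [v]
    and [x], [y]. If neither ascent dominates, then [u], [k], [y], [m] form a 2143. *)
Lemma covered_dominated n (s : 'S_n) k0 : avoids2143 s -> k0 \in covered s ->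
  exists x y, dominates s (covered s) x y.
Proof.
move=> av Pk0.
case: (arg_minnP (fun k : 'I_n => k : nat) Pk0) => k Pk min_k.
case: (arg_maxnP (fun k : 'I_n => s k : nat) Pk0) => m Pm max_m.
have /coveredP[u [v [uv vk ku lt_uv]]] := Pk.
have /coveredP[x [y [xy ym mx lt_xy]]] := Pm.
have [lt_mu|le_um] := ltnP (s m) (s u).
  exists u, v; split=> // p Pp.
  by have := min_k _ Pp; have := max_m _ Pp; lia.
have [lt_yk|le_ky] := ltnP y k.
  exists x, y; split=> // p Pp.
  by have := min_k _ Pp; have := max_m _ Pp; lia.
have su_m : s u != s m :> nat.
  by apply/eqP => /val_inj/perm_inj eq_um; have := min_k _ Pm; rewrite -eq_um; lia.
have sk_y : k != y :> nat.
  by apply/eqP => /val_inj eq_ky; have := max_m _ Pk; rewrite eq_ky; lia.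
have := av u k y m; lia.
Qed.

(** * Reversing the covered entries in place *)

Definition monotone_on n (s : 'S_n) (P : {set 'I_n}) (up : bool) :=
  {in P &, forall i j : 'I_n, i < j -> if up then s i < s j else s j < s i}.

(** The left factor of a product acts first, so the reversal acts on positions. *)
Definition flip n (s : 'S_n) : 'S_n := (rev_perm (covered s) * s)%g.

Lemma flip_out n (s : 'S_n) i : i \notin covered s -> flip s i = s i.
Proof. by move=> nPi; rewrite permM rev_perm_out. Qed.

Lemma flip_in n (s : 'S_n) i : i \in covered s ->
  exists2 j, j \in covered s & flip s i = s j.
Proof. by move=> Pi; exists (rev_perm (covered s) i); rewrite ?rev_perm_in ?permM. Qed.

Lemma monotone_flip n (s : 'S_n) up :
  monotone_on s (covered s) up -> monotone_on (flip s) (covered s) (~~ up).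
Proof.
move=> mono i j Pi Pj ltij; rewrite !permM.
have := mono _ _ (rev_perm_in Pj) (rev_perm_in Pi) (rev_perm_anti Pi Pj ltij).
by case: up mono.
Qed.

(** Otherwise [x], [y], [k] would be a 231 covering [k]. *)
Lemma dominates_uncovered n (s : 'S_n) (x y k : 'I_n) : dominates s (covered s) x y ->
  y < k -> k \notin covered s -> s x < s k.
Proof.
case=> xy lt_xy _ yk; apply: contraR; rewrite -leqNgt leq_eqVlt.
case/predU1P => [/val_inj/perm_inj eq_kx|lt_kx]; first by rewrite eq_kx in yk; lia.
by apply/coveredP; exists x, y.
Qed.

Lemma dominates_notin n (s : 'S_n) (P : {set 'I_n}) x y : dominates s P x y ->
  x \notin P /\ y \notin P.
Proof. by case=> xy lt_xy dom; split; apply/negP => /dom; lia. Qed.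

Lemma dominates_flip n (s : 'S_n) x y : dominates s (covered s) x y ->
  dominates (flip s) (covered s) x y.
Proof.
move=> dom; have [nPx nPy] := dominates_notin dom; case: dom => xy lt_xy dom.
rewrite /dominates !flip_out //; split=> // k Pk; split; first by case: (dom k Pk).
by have [j Pj ->] := flip_in Pk; case: (dom j Pj).
Qed.

(** The dominating ascent is uncovered, hence fixed by [flip], and still covers the same positions.
    Nothing new gets covered: a 231 ending at an uncovered [k] cannot start with covered entries,
    since [k] would then exceed [s x], so it already occurs in [s]. *)
Lemma covered_flip n (s : 'S_n) : avoids2143 s -> covered (flip s) = covered s.
Proof.
move=> av; have [P0|[k0 Pk0]] := set_0Vmem (covered s).
  congr covered; apply/permP => i; apply: flip_out.
  by rewrite P0 inE.
have [x [y dom]] := covered_dominated av Pk0.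
have [xy lt_xy domt] := dominates_flip dom.
apply/setP => k; apply/idP/idP => [/coveredP[i [j [ij jk lt_ki lt_ij]]]|Pk]; last first.
  by apply/coveredP; exists x, y; case: (domt k Pk).
apply: contraLR lt_ki => nPk; rewrite -leqNgt.
have [nPx nPy] := dominates_notin dom.
have := dominates_uncovered dom (k := k) _ nPk.
rewrite -(flip_out nPk) -(flip_out nPx).
have [/domt|nPi] := boolP (i \in covered s); first lia.
have [/domt|nPj] := boolP (j \in covered s); first lia.
move=> _; move: lt_ij; rewrite !flip_out // => lt_ij; rewrite leqNgt.
by apply: contra nPk => lt_ki; apply/coveredP; exists i, j.
Qed.

(** * Convexity of the covered set in positions or in values *)

Definition position_convex n (P : {set 'I_n}) := forall c p q : 'I_n,
  c \notin P -> p \in P -> q \in P -> p < c -> q < c.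

Definition value_convex n (s : 'S_n) (P : {set 'I_n}) := forall a p q : 'I_n,
  a \notin P -> p \in P -> q \in P -> s p < s a -> s q < s a.

Lemma notin_neq n (s : 'S_n) (P : {set 'I_n}) i j : i \notin P -> j \in P ->
  i != j :> nat /\ s i != s j :> nat.
Proof.
move=> nPi Pj; split; apply: contra nPi => /eqP; first by move=> /val_inj ->.
by move=> /val_inj/perm_inj ->.
Qed.

(** Suppose the value at an uncovered [a] and an uncovered position [c] both separate covered ones.
    With [i] and [j] the leftmost and rightmost covered positions, [a], [i], [c], [j] form a 2143 if
    the covered entries increase and a 2341 if they decrease. *)
Lemma convex_dichotomy n (s : 'S_n) x y up :
  avoids2143 s -> avoids2341 s -> dominates s (covered s) x y ->
  monotone_on s (covered s) up ->
  position_convex (covered s) \/ value_convex s (covered s).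
Proof.
move=> av2143 av2341 dom mono; have [xy lt_xy below] := dom.
have [/existsP[a /existsP[p /existsP[q /and5P[nPa Pp Pq lt_pa lt_aq]]]]|] :=
    boolP [exists a : 'I_n, exists p : 'I_n, exists q : 'I_n,
      [&& a \notin covered s, p \in covered s, q \in covered s, s p < s a & s a < s q]].
  left=> c p' q' nPc Pp' Pq' lt_p'c.
  have [neq_cq' _] := notin_neq s nPc Pq'; rewrite ltnNge; apply/negP => le_cq'.
  case: (arg_minnP (fun k : 'I_n => k : nat) Pp) => i Pi min_i.
  case: (arg_maxnP (fun k : 'I_n => k : nat) Pp) => j Pj max_j.
  (* To the right of [y], the uncovered [a] would exceed [s x], hence all covered values. *)
  have lt_ay : a < y.
    have neq_ay : a != y :> nat.
      apply/eqP => /val_inj eq_ay; move: lt_aq; rewrite eq_ay.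
      by have [_ ] := below q Pq; lia.
    have := dominates_uncovered dom (k := a) _ nPa.
    have := below q Pq; lia.
  have lt_yi : y < i by case: (below i Pi).
  have lt_xc : s x < s c.
    by apply: dominates_uncovered dom _ nPc; have := min_i _ Pp'; lia.
  have [lt_ic lt_cj] : i < c /\ c < j.
    by have := min_i _ Pp'; have := max_j _ Pq'; lia.
  have [_ lt_ix] := below i Pi; have [_ lt_jx] := below j Pj.
  have weak (k l : 'I_n) : k \in covered s -> l \in covered s -> k <= l ->
      if up then s k <= s l else s l <= s k.
    move=> Pk Pl; rewrite leq_eqVlt => /orP[/eqP/val_inj ->|lt_kl].
      by case: (up).
    by have := mono k l Pk Pl lt_kl; case: (up) => /ltnW.
  have := (weak i p Pi Pp (min_i _ Pp), weak i q Pi Pq (min_i _ Pq)).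
  have := (weak p j Pp Pj (max_j _ Pp), weak q j Pq Pj (max_j _ Pq)).
  case: (up) => -[lt_pj lt_qj] [lt_ip lt_iq].
    by have := av2143 a i c j; lia.
  by have := av2341 a i c j; lia.
rewrite negb_exists => /forallP no_a; right=> a p q nPa Pp Pq lt_pa.
have [_ neq_aq] := notin_neq s nPa Pq; rewrite ltnNge; apply: contra (no_a a) => le_aq.
apply/existsP; exists p; apply/existsP; exists q.
by rewrite nPa Pp Pq lt_pa /= ltn_neqAle neq_aq.
Qed.

(** * Avoidance of 2143 and 2341 survives the reversal *)

(** An occurrence in [flip s] is split by which of its entries are covered. Each case contradicts
    monotonicity or convexity, or yields an occurrence in [s] after replacing entries by [x], by [y]
    or by covered ones. *)
Lemma flip_avoids n (s : 'S_n) up :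
  avoids2143 s -> avoids2341 s -> monotone_on s (covered s) up ->
  avoids2143 (flip s) /\ avoids2341 (flip s).
Proof.
move=> av2143 av2341 mono.
have [P0|[k0 Pk0]] := set_0Vmem (covered s).
  suff -> : flip s = s by [].
  by apply/permP => i; apply: flip_out; rewrite P0 inE.
have [x [y dom]] := covered_dominated av2143 Pk0.
have [xy lt_xy below] := dom; have [nPx nPy] := dominates_notin dom.
have belowt (p : 'I_n) : p \in covered s -> y < p /\ flip s p < s x.
  by have [_ _ domt] := dominates_flip dom; rewrite -(flip_out nPx); apply: domt.
have above (p c : 'I_n) : p \in covered s -> c \notin covered s -> p < c -> s x < s c.
  move=> /below[lt_yp _] nPc lt_pc; apply: (dominates_uncovered dom) => //; lia.
have before (p a : 'I_n) : p \in covered s -> a \notin covered s ->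
    s a < flip s p -> a < y.
  move=> Pp nPa lt_ap; have [_ lt_px] := belowt p Pp.
  rewrite ltn_neqAle; apply/andP; split.
    by apply/eqP => /val_inj eq_ay; move: lt_ap; rewrite eq_ay; lia.
  by rewrite leqNgt; apply/negP => /(dominates_uncovered dom)/(_ nPa); lia.
have monot := monotone_flip mono.
have convex := convex_dichotomy av2143 av2341 dom mono.
split=> a b c d lt_ab lt_bc lt_cd; apply/negP => /and3P[].
- move=> lt_ba lt_ad lt_dc.
  have [Pa|nPa] := boolP (a \in covered s).
    have Pb : b \in covered s.
      apply: contraLR lt_ba => nPb; rewrite (flip_out nPb).
      have := above a b Pa nPb lt_ab; have := belowt a Pa; lia.
    have nPc : c \notin covered s.
      apply/negP => Pc; have := monot a b Pa Pb lt_ab; have := monot b c Pb Pc lt_bc.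
      by case: (up) => /=; lia.
    have nPd : d \notin covered s.
      apply/negP => Pd; have := monot a b Pa Pb lt_ab.
      by have := monot b d Pb Pd; case: (up) => /=; lia.
    move: lt_dc; rewrite !flip_out // => lt_dc.
    (* Here [a] and [b] are covered, and [x] takes over the role of [a]. *)
    have := above b d Pb nPd; have := below b Pb; have := av2143 x b c d; lia.
  rewrite (flip_out nPa) in lt_ba lt_ad.
  have [Pc|nPc] := boolP (c \in covered s).
    have Pd : d \in covered s.
      apply: contraLR lt_dc => nPd; rewrite (flip_out nPd).
      have := above c d Pc nPd lt_cd; have := belowt c Pc; lia.
    have nPb : b \notin covered s.
      apply/negP => Pb; have := monot b c Pb Pc lt_bc.
      by have := monot c d Pc Pd lt_cd; case: (up) => /=; lia.
    rewrite (flip_out nPb) in lt_ba.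
    have lt_by : b < y by apply: (before d) => //; lia.
    have [d' Pd' eq_d] := flip_in Pd; rewrite eq_d in lt_ad.
    (* Here [c] and [d] are covered; [y] replaces [c], and [d'] carries in [s] the value that
       [flip s] has at [d]. *)
    have := below d' Pd'; have := av2143 a b y d'; lia.
  rewrite (flip_out nPc) in lt_dc.
  (* If [b] and [d] are both covered, [c] separates positions and [a] values, against convexity. If
     just one is, position convexity allows moving to where [s] has the same value, and value
     convexity allows keeping the position with its value in [s]. *)
  have [Pb|nPb] := boolP (b \in covered s); have [Pd|nPd] := boolP (d \in covered s).
  + case: convex => [pc|vc]; first by have := pc c b d nPc Pb Pd; lia.
    have [b' Pb' eq_b] := flip_in Pb; have [d' Pd' eq_d] := flip_in Pd.
    by rewrite eq_b eq_d in lt_ba lt_ad; have := vc a b' d' nPa Pb' Pd'; lia.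
  + have [b' Pb' eq_b] := flip_in Pb; rewrite eq_b in lt_ba.
    rewrite (flip_out nPd) in lt_ad lt_dc.
    case: convex => [pc|vc].
      have := pc c b b' nPc Pb Pb' lt_bc; have := pc a b' b nPa Pb' Pb.
      have := notin_neq s nPa Pb'; have := av2143 a b' c d; lia.
    by have := vc a b' b nPa Pb' Pb; have := av2143 a b c d; lia.
  + have [d' Pd' eq_d] := flip_in Pd; rewrite eq_d in lt_ad lt_dc.
    rewrite (flip_out nPb) in lt_ba.
    case: convex => [pc|vc].
      have := pc c d' d nPc Pd' Pd; have := notin_neq s nPc Pd'.
      by have := av2143 a b c d'; lia.
    have := vc c d' d nPc Pd' Pd; have := vc a d d' nPa Pd Pd'.
    by have := notin_neq s nPa Pd; have := av2143 a b c d; lia.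
  + rewrite (flip_out nPb) in lt_ba; rewrite (flip_out nPd) in lt_ad lt_dc.
    by have := av2143 a b c d; lia.
- move=> lt_da lt_a_b lt_b_c.
  (* The entries at [a], [b], [d] form a 231 in [flip s], whose covered set is that of [s]. *)
  have [Pd|nPd] := boolP (d \in covered s); last first.
    case/negP: (nPd); rewrite -(covered_flip av2143).
    by apply/coveredP; exists a, b; split=> //; lia.
  have [Pc|nPc] := boolP (c \in covered s).
    have := monot c d Pc Pd lt_cd => mono_cd.
    have nPa : a \notin covered s.
      by apply/negP => Pa; have := monot a c Pa Pc; move: mono_cd; case: (up) => /=; lia.
    have nPb : b \notin covered s.
      by apply/negP => Pb; have := monot b c Pb Pc; move: mono_cd; case: (up) => /=; lia.
    rewrite (flip_out nPa) in lt_da lt_a_b; rewrite (flip_out nPb) in lt_a_b lt_b_c.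
    have lt_by := before c b Pc nPb lt_b_c.
    have [d' Pd' eq_d] := flip_in Pd; rewrite eq_d in lt_da.
    have := below d' Pd'; have := belowt c Pc; have := av2341 a b y d'; lia.
  rewrite (flip_out nPc) in lt_b_c.
  have [Pb|nPb] := boolP (b \in covered s).
    have nPa : a \notin covered s.
      apply/negP => Pa; have := monot a b Pa Pb; have := monot b d Pb Pd.
      by case: (up) => /=; lia.
    case: convex => [pc|vc]; first by have := pc c b d nPc Pb Pd; lia.
    have [b' Pb' eq_b] := flip_in Pb; have [d' Pd' eq_d] := flip_in Pd.
    rewrite (flip_out nPa) eq_b eq_d in lt_da lt_a_b.
    by have := vc a d' b' nPa Pd' Pb'; lia.
  rewrite (flip_out nPb) in lt_a_b lt_b_c.
  have [Pa|nPa] := boolP (a \in covered s).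
    have := above a b Pa nPb lt_ab; have := below d Pd; have := below a Pa.
    have := av2341 x b c d; lia.
  have [d' Pd' eq_d] := flip_in Pd; rewrite (flip_out nPa) eq_d in lt_da lt_a_b.
  (* Only [d] is covered: either its value is followed to [d'], or its position is kept. *)
  case: convex => [pc|vc].
    have := pc c d' d nPc Pd' Pd; have := notin_neq s nPc Pd'.
    by have := av2341 a b c d'; lia.
  by have := vc a d' d nPa Pd' Pd; have := av2341 a b c d; lia.
Qed.

(** * 3412 and 3421 as monotonicity of the covered entries *)

(** The dominating ascent followed by two increasing covered entries is a 3412; conversely the last
    two entries of a 3412 are covered by its first two. *)
Lemma monotone_avoids3412 n (s : 'S_n) : avoids2143 s ->
  avoids3412 s <-> monotone_on s (covered s) false.
Proof.
move=> av2143; split=> [av i j Pi Pj lt_ij|mono i j k l lt_ij lt_jk lt_kl].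
  have [x [y [xy lt_xy below]]] := covered_dominated av2143 Pi.
  have s_neq : s i != s j :> nat.
    by apply/eqP => /val_inj/perm_inj eq_ij; rewrite eq_ij ltnn in lt_ij.
  have := av x y i j; have := below i Pi; have := below j Pj; lia.
apply/negP => /and3P[lt1 lt2 lt3].
have Pk : k \in covered s by apply/coveredP; exists i, j; split=> //; lia.
have Pl : l \in covered s by apply/coveredP; exists i, j; split=> //; lia.
by have := mono k l Pk Pl lt_kl; lia.
Qed.

Lemma monotone_avoids3421 n (s : 'S_n) : avoids2143 s ->
  avoids3421 s <-> monotone_on s (covered s) true.
Proof.
move=> av2143; split=> [av i j Pi Pj lt_ij|mono i j k l lt_ij lt_jk lt_kl].
  have [x [y [xy lt_xy below]]] := covered_dominated av2143 Pi.
  have s_neq : s i != s j :> nat.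
    by apply/eqP => /val_inj/perm_inj eq_ij; rewrite eq_ij ltnn in lt_ij.
  have := av x y i j; have := below i Pi; have := below j Pj; lia.
apply/negP => /and3P[lt1 lt2 lt3].
have Pk : k \in covered s by apply/coveredP; exists i, j; split=> //; lia.
have Pl : l \in covered s by apply/coveredP; exists i, j; split=> //; lia.
by have := mono k l Pk Pl lt_kl; lia.
Qed.

(** * The involution and the bijection *)

Lemma flipK n (s : 'S_n) : avoids2143 s -> flip (flip s) = s.
Proof.
move=> av; rewrite {1}/flip (covered_flip av) /flip.
by rewrite mulgA rev_permK mul1g.
Qed.

Lemma avoiders3412P n (s : 'S_n) :
  s \in avoiders n [:: [:: 2; 1; 4; 3]; [:: 2; 3; 4; 1]; [:: 3; 4; 1; 2]] <->
  [/\ avoids2143 s, avoids2341 s & monotone_on s (covered s) false].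
Proof.
rewrite inE /= andbT; split=> [/and3P[av1 av2 av3]|[av1 av2 mono]].
  have av := (avoids2143P s).2 av1.
  by split=> //; [apply/avoids2341P | apply/monotone_avoids3412/avoids3412P].
apply/and3P; split; first exact/avoids2143P; first exact/avoids2341P.
exact/avoids3412P/monotone_avoids3412.
Qed.

Lemma avoiders3421P n (s : 'S_n) :
  s \in avoiders n [:: [:: 2; 1; 4; 3]; [:: 2; 3; 4; 1]; [:: 3; 4; 2; 1]] <->
  [/\ avoids2143 s, avoids2341 s & monotone_on s (covered s) true].
Proof.
rewrite inE /= andbT; split=> [/and3P[av1 av2 av3]|[av1 av2 mono]].
  have av := (avoids2143P s).2 av1.
  by split=> //; [apply/avoids2341P | apply/monotone_avoids3421/avoids3421P].
apply/and3P; split; first exact/avoids2143P; first exact/avoids2341P.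
exact/avoids3421P/monotone_avoids3421.
Qed.

Theorem theorem5 (n : nat) :
  exists f : {s : 'S_n | s \in avoiders n [:: [:: 2; 1; 4; 3]; [:: 2; 3; 4; 1]; [:: 3; 4; 1; 2]]} ->
             {s : 'S_n | s \in avoiders n [:: [:: 2; 1; 4; 3]; [:: 2; 3; 4; 1]; [:: 3; 4; 2; 1]]},
    bijective f.
Proof.
have flip_mono (s : 'S_n) up :
    [/\ avoids2143 s, avoids2341 s & monotone_on s (covered s) up] ->
    [/\ avoids2143 (flip s), avoids2341 (flip s) &
        monotone_on (flip s) (covered (flip s)) (~~ up)].
  case=> av1 av2 mono; have [av1f av2f] := flip_avoids av1 av2 mono.
  by split=> //; rewrite covered_flip //; apply: monotone_flip.
(* [flip_mono] negates [up], and [~~ false] computes to [true], so [flip] lands in the other class;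
   the inverse is [flip] again. *)
exists (fun u => exist _ (flip (val u))
  ((avoiders3421P _).2 (flip_mono _ _ ((avoiders3412P _).1 (valP u))))).
exists (fun u => exist _ (flip (val u))
  ((avoiders3412P _).2 (flip_mono _ _ ((avoiders3421P _).1 (valP u))))).
- move=> u; apply: val_inj; apply: flipK.
  by have /avoiders3412P[] := valP u.
- move=> u; apply: val_inj; apply: flipK.
  by have /avoiders3421P[] := valP u.
Qed.
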